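(* For every $S\in\mathbb{N}$ there exists $i_0\in\mathbb{N}$ such that for all $i>i_0$ we have $$\Pr\big(\mathbb{K}_i\text{ contains a subcongruent }S\text{-cube}\big)<2^{-5^{S_i}}.$$
   Context: $\mathbb{N}=\{0,1,2,\ldots\}$, $\mu$ is Lebesgue measure on $\mathbb{R}^3$, $\operatorname{Iso}(\mathbb{R}^3)$ is the isometry group of $\mathbb{R}^3$, and $K_0=[0,1]^3$. Dyadic cubes. For $i\in\mathbb{N}$, a dyadic $i$-cube (or $i$-cube) is a closed solid cube with side length $2^{-i}$ whose corners have coordinates of the form $(\frac{a}{2^i},\frac{b}{2^i},\frac{c}{2^i})$ with $a,b,c\in\{0,1,\ldots,2^i\}$. A dyadic cube is a dyadic $i$-cube for some $i$. A dyadic complex is a union of finitely many dyadic cubes; a dyadic $i$-complex is a dyadic complex which is a union of dyadic $i$-cubes. Parameters. Fix $p\in(0,1)$, a sequence $(p_i)_{i\in\mathbb{N}}$ of rational numbers with $p_0=1$ and $p_i\in(0,1)$ for $i\ge1$, and a sequence $(s_i)_{i\in\mathbb{N}}$ of positive natural numbers. Let $P_i=\prod_{j\le i}p_j$ and $S_i=\sum_{j\le i}s_j$. Assume: $\prod_{i\in\mathbb{N}}p_i=p$; and for all $i\in\mathbb{N}$: $p_i8^{s_i}\in\mathbb{N}$, $(1-p_{i+1})8^{S_i}\ge7^{S_i}$, and $3\cdot8^{S_i}\le s_{i+1}$. Random sets. The random sequence $(\mathbb{K}_i)_{i\in\mathbb{N}}$ of compact subsets of $K_0$ is defined by $\mathbb{K}_0=K_0$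 and inductively: $\mathbb{K}_i$ is a union of distinct $S_i$-cubes; each of these is subdivided into $8^{s_{i+1}}$ dyadic $S_{i+1}$-cubes, of which exactly $p_{i+1}8^{s_{i+1}}$ are chosen uniformly at random, independently for different $S_i$-cubes; $\mathbb{K}_{i+1}$ is the union of all chosen cubes. Subcongruence. Let $K$ be a dyadic complex and $A$ a dyadic $S$-cube. $A$ is subcongruent in $K$ if $\mu(A\cap K)>0$ and there exists $\gamma\in\operatorname{Iso}(\mathbb{R}^3)\setminus\{\operatorname{Id}\}$ such that $A\cap\gamma(A)=\emptyset$ and $\gamma(A\cap K)\subset K$. $K$ contains a subcongruent $S$-cube if there exists an $S$-cube which is subcongruent in $K$. *)

(* Defs.v *)
From mathcomp Require Import all_boot all_order all_algebra.
From mathcomp Require Import all_classical all_reals all_analysis.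

Set Implicit Arguments.
Unset Strict Implicit.
Unset Printing Implicit Defensive.

Import Order.TTheory GRing.Theory Num.Theory.
Import numFieldNormedType.Exports.

Local Open Scope classical_set_scope.
Local Open Scope ring_scope.

(* R^3 is the product R * R * R, which carries the product sigma-algebra; its
   library norm is the sup norm, hence the separate Euclidean distance below. *)
Definition space3 (R : realType) : Type := (R * R * R)%type.

Definition lebesgue3 (R : realType) : set (space3 R) -> \bar R :=
  ((@lebesgue_measure R \x @lebesgue_measure R) \x @lebesgue_measure R)%E.

Definition edist (R : realType) (x y : space3 R) : R :=
  Num.sqrt ((x.1.1 - y.1.1) ^+ 2 + (x.1.2 - y.1.2) ^+ 2 + (x.2 - y.2) ^+ 2).

Definition isometry3 (R : realType) (g : space3 R -> space3 R) : Prop :=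
  bijective g /\ forall x y, edist (g x) (g y) = edist x y.

(* A dyadic n-cube is encoded by the numerators of its least corner
   (a/2^n, b/2^n, c/2^n), so that 0 <= a, b, c < 2^n. *)
Definition dcube (n : nat) : Type := ('I_(2 ^ n) * 'I_(2 ^ n) * 'I_(2 ^ n))%type.

Definition dside (R : realType) (n : nat) (a : 'I_(2 ^ n)) : set R :=
  [set t | (a%:R / 2 ^+ n <= t) && (t <= a.+1%:R / 2 ^+ n)].

Definition cube (R : realType) (n : nat) (Q : dcube n) : set (space3 R) :=
  [set x | dside Q.1.1 x.1.1 /\ dside Q.1.2 x.1.2 /\ dside Q.2 x.2].

Definition dcomplex (R : realType) (n : nat) (F : {set dcube n}) :
    set (space3 R) :=
  [set x | exists2 Q, Q \in F & cube Q x].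

Definition subcongruent (R : realType) (S : nat) (A : dcube S)
    (K : set (space3 R)) : Prop :=
  (0 < lebesgue3 (cube A `&` K))%E /\
  exists g : space3 R -> space3 R,
    [/\ isometry3 g, g <> id, cube A `&` g @` cube A = set0 &
        g @` (cube A `&` K) `<=` K].

Definition contains_subcongruent (R : realType) (S : nat)
    (K : set (space3 R)) : Prop :=
  exists A : dcube S, subcongruent A K.

Definition psum (s : nat -> nat) (i : nat) : nat := (\sum_(j < i.+1) s j)%N.

Definition pprod (p_ : nat -> rat) (i : nat) : rat := \prod_(j < i.+1) p_ j.

(* For m <= n: the n-cubes contained in the m-cube Q. *)
Definition subcubes (m n : nat) (Q : dcube m) : {set dcube n} :=
  [set B : dcube n | [&& (B.1.1 %/ 2 ^ (n - m) == Q.1.1 :> nat)%N,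
                         (B.1.2 %/ 2 ^ (n - m) == Q.1.2 :> nat)%N &
                         (B.2 %/ 2 ^ (n - m) == Q.2 :> nat)%N]]%SET.

Definition choices (p_ : nat -> rat) (s : nat -> nat) (i : nat)
    (Q : dcube (psum s i)) : {set {set dcube (psum s i.+1)}} :=
  [set C : {set dcube (psum s i.+1)} |
    (C \subset subcubes (psum s i.+1) Q) &&
    (#|C|%:R == p_ i.+1 * 8 ^+ s i.+1)]%SET.

(* F i w is the (random) family of (psum s i)-cubes whose union is the i-th
   random set.  The last clause says that, conditionally on the families up to
   stage i being A 0, ..., A i, the sub-families chosen inside the cubes Q of
   A i are independent and uniformly distributed on choices p_ s Q; it is
   multiplied out so that histories of probability zero are harmless. *)
Record random_cubes (d : measure_display) (T : measurableType d)
    (R : realType) (P : probability T R) (p_ : nat -> rat) (s : nat -> nat)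
    (F : forall i : nat, T -> {set dcube (psum s i)}) : Prop := RandomCubes {
  rc_measurable : forall i A, measurable [set w | F i w = A];
  rc_init : forall w, F 0 w = [set: dcube (psum s 0)]%SET;
  rc_chosen : forall i w Q, Q \in F i w ->
    (F i.+1 w :&: subcubes (psum s i.+1) Q)%SET \in choices p_ Q;
  rc_union : forall i w, F i.+1 w =
    (\bigcup_(Q in F i w) (F i.+1 w :&: subcubes (psum s i.+1) Q))%SET;
  rc_law : forall (i : nat) (A : forall j : nat, {set dcube (psum s j)})
      (C : dcube (psum s i) -> {set dcube (psum s i.+1)}),
    (forall Q, Q \in A i -> C Q \in choices p_ Q) ->
    let history := [set w | forall j, (j <= i)%N -> F j w = A j] in
    P (history `&` [set w | forall Q, Q \in A i ->
                      (F i.+1 w :&: subcubes (psum s i.+1) Q)%SET = C Q])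
    = (P history * (\prod_(Q in A i) (#|choices p_ Q|%:R)^-1)%:E)%E
}.

(* Main.v *)
Require Import Defs.
From mathcomp Require Import all_boot all_order all_algebra.
From mathcomp Require Import all_classical all_reals all_analysis.
From mathcomp Require Import zify ring lra.

Set Implicit Arguments.
Unset Strict Implicit.
Unset Printing Implicit Defensive.

Import Order.TTheory GRing.Theory Num.Theory.
Import numFieldNormedType.Exports.

Local Open Scope classical_set_scope.
Local Open Scope ring_scope.

(** Fix i, let M = S_i and N = S_(i+1) be the two consecutive scales, and
condition on everything up to the i-th random set, a family A of M-cubes.
Suppose that the next random set K, a union of a family V of N-cubes, contains
a subcongruent S-cube, with witnesses A0 and g.  Since A0 meets K in positive
measure, some N-cube of V lies in A0, and its ancestor Q in A is an M-cube
inside A0.  For every N-cube B of Q that belongs to V the isometry carries B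
into K, so the N-cube phi(B) that contains g(center of B) belongs to V as well.
As g(A0) misses A0, phi(B) lies outside Q; and if only the cubes B whose three
indices are even are used, their centers are so far apart that phi is
injective on them.  So V satisfies 8^(s_(i+1)-1) implications of the form
<<B in V implies phi(B) in V>>, and these involve pairwise disjoint pairs of
cubes.

If the N-cubes below A were chosen independently with probability
q = p_(i+1), each implication would fail with probability at least q(1 - q),
so that all of them would hold with probability at most
(1 - q(1 - q))^(8^(s_(i+1)-1)) ([mean_implications]).  The actual choice is
uniform among subsets of prescribed size k = q n of the n = 8^(s_(i+1)) cubes
below each cube of A.  The number k is the most likely value of a binomial
variable with parameters n and q, and therefore has probability at least
1/(n+1): passing from uniform subsets to independent choices costs a factor of
at most (n+1)^(8^M) ([uniform_le_bernoulli], [refinement_prob_le_weight]).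

It remains to sum over all Q and all maps phi.  An isometry is affine with
orthonormal linear part, hence given by twelve real numbers; as it carries
some point of the unit cube into the unit cube, they all lie in [-4, 4).
Rounding them to multiples of 2^-(N+6) displaces the image of each center by
so little that the rounded map still defines a map phi with the properties
above ([subcongruence_code]).  So at most 2^(12(N+9)) maps phi need to be
considered.  Finally, q is bounded below by p and 1 - q by (7/8)^M, and
s_(i+1) is at least 3 8^M, so the exponent 8^(s_(i+1)-1) p (7/8)^M dominates
5^N and the logarithms of all the other factors ([union_bound_small]). *)

(** * Independent choices *)

Section RandomSubset.
Variables (R : realType) (X : finType) (f : X -> bool -> R).
Hypothesis f_ge0 : forall x b, 0 <= f x b.
Hypothesis f_sum1 : forall x, f x true + f x false = 1.

Definition weight (V : {set X}) : R := \prod_x f x (x \in V).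

Definition mean (G : {set X} -> R) : R := \sum_V weight V * G V.

Lemma weight_ge0 V : 0 <= weight V.
Proof. by apply: prodr_ge0. Qed.

(** Conditioning on the single coordinate x; every independence statement
below comes from this formula. *)
Lemma mean_split x G :
  mean G = \sum_(V : {set X} | x \notin V) (\prod_(y | y != x) f y (y \in V)) *
    (f x true * G (x |: V)%SET + f x false * G V).
Proof.
rewrite /mean (bigID (fun V : {set X} => x \in V)) /=.
rewrite (reindex_onto (fun V => x |: V)%SET (fun V => V :\ x)%SET) /=; last first.
  by move=> V xV; rewrite finset.setD1K.
rewrite [X in X + _](eq_bigl (fun V : {set X} => x \notin V)); last first.
  move=> V; rewrite finset.setU11 /=; apply/eqP/idP => [<-|xV].
    by rewrite finset.setD11.
  by rewrite finset.setU1K.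
rewrite -big_split; apply: eq_bigr => V xV /=.
rewrite /weight (bigD1 x) //= (bigD1 x (P := predT)) //=.
rewrite finset.setU11 (negbTE xV).
have -> : \prod_(y | y != x) f y (y \in (x |: V)%SET) =
          \prod_(y | y != x) f y (y \in V).
  by apply: eq_bigr => y /negbTE yx; rewrite finset.in_setU1 yx.
ring.
Qed.

Lemma mean1 : mean (fun=> 1) = 1.
Proof.
rewrite /mean /weight.
under eq_bigr do rewrite mulr1.
transitivity (\prod_x \sum_b f x b).
  rewrite bigA_distr_bigA /=.
  rewrite (reindex_onto (fun g : {ffun X -> bool} => [set x | g x]%SET)
            (fun V : {set X} => [ffun x => x \in V])) /=.
    apply: eq_big => [g|g _].
      by apply/eqP/ffunP => x; rewrite ffunE inE.
    by apply: eq_bigr => x _; rewrite inE.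
  by move=> V _; apply/setP => x; rewrite inE ffunE.
by apply: big1 => x _; rewrite big_bool; apply: f_sum1.
Qed.

(** A function that ignores the coordinate x is independent of every function
of that coordinate. *)
Lemma mean_indep x G (a : bool -> R) :
  (forall V, G (x |: V)%SET = G V) ->
  mean (fun V => G V * a (x \in V)) =
  mean G * (f x true * a true + f x false * a false).
Proof.
move=> Gx; rewrite (mean_split x) [mean G](mean_split x) mulr_suml.
apply: eq_bigr => V xV; rewrite Gx finset.setU11 (negbTE xV).
have := f_sum1 x => fx; have -> : f x false = 1 - f x true by rewrite -fx; ring.
ring.
Qed.

(** The value None of phi b stands for a target that can never be chosen, so
that b itself must not be chosen. *)
Definition holds (phi : X -> option X) (V : {set X}) (b : X) : bool :=
  (b \in V) ==> (if phi b is Some b' then b' \in V else false).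

Lemma holds_setU1 (phi : X -> option X) x (V : {set X}) b :
  b != x -> phi b != Some x -> holds phi (x |: V)%SET b = holds phi V b.
Proof.
move=> bx px; rewrite /holds finset.in_setU1 (negbTE bx) /=.
case E: (phi b) px => [b'|] //= px.
rewrite finset.in_setU1 (_ : (b' == x) = false) //.
by apply: contraNF px => /eqP ->.
Qed.

(** The pairs (b, phi b) are pairwise disjoint, so the implications are
independent events, each of which fails with probability q times the
probability that phi b is not chosen. The induction adds one pair at a time:
the implications already treated ignore both of its coordinates. *)
Lemma mean_implications (phi : X -> option X) (L : seq X) (q : R) :
  uniq L ->
  (forall b b', b \in L -> phi b = Some b' -> b' \notin L) ->
  (forall b1 b2 b', b1 \in L -> b2 \in L ->
     phi b1 = Some b' -> phi b2 = Some b' -> b1 = b2) ->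
  (forall b, b \in L -> f b true = q) -> (forall x, 1 - q <= f x false) ->
  \sum_(V : {set X} | all (holds phi V) L) weight V
    <= (1 - q * (1 - q)) ^+ size L.
Proof.
move=> uL phiL phi_inj fL fq.
have -> : \sum_(V : {set X} | all (holds phi V) L) weight V =
          mean (fun V => (all (holds phi V) L)%:R).
  by rewrite /mean big_mkcond; apply: eq_bigr => V _; case: all;
    rewrite ?mulr1 ?mulr0.
elim: L uL phiL phi_inj fL => [|b L IH] /=.
  by rewrite expr0 => *; rewrite mean1.
case/andP=> bL uL phiL phi_inj fL.
have bbL : b \in b :: L by exact: mem_head.
have sL y : y \in L -> y \in b :: L by move=> yL; rewrite in_cons yL orbT.
set G := fun V : {set X} => (all (holds phi V) L)%:R : R.
have IHG : mean G <= (1 - q * (1 - q)) ^+ size L.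
  apply: IH => //.
  - by move=> y y' /sL yL /(phiL _ _ yL); rewrite in_cons negb_or => /andP[].
  - by move=> b1 b2 b' /sL b1L /sL b2L; apply: phi_inj.
  - by move=> y /sL; apply: fL.
have G_indep x : x \notin L -> (forall y, y \in L -> phi y != Some x) ->
    forall V, G (x |: V)%SET = G V.
  move=> xL px V; congr (_%:R); congr nat_of_bool; apply: eq_in_all => y yL.
  apply: holds_setU1 (px _ yL).
  by apply: contraNneq xL => <-.
have Gb : forall V, G (b |: V)%SET = G V.
  apply: G_indep => // y yL; apply/eqP => /(phiL _ _ (sL _ yL)).
  by rewrite bbL.
have q0 : 0 <= q by rewrite -(fL b) // f_ge0.
have q1 : 0 <= 1 - q.
  by have := f_sum1 b; rewrite fL //; have := f_ge0 b false; lra.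
have Gb1 : mean (fun V => G V * (b \in V)%:R) = mean G * q.
  rewrite (mean_indep (fun c => c%:R : R) Gb) /= fL //; ring.
have Gge0 : 0 <= mean G.
  by apply: sumr_ge0 => V _; rewrite mulr_ge0 ?weight_ge0 ?ler0n.
(* The conjunct for b fails exactly when b is chosen and its image is not. *)
have [c [cq ->]] : exists c : R, 1 - q <= c /\
    mean (fun V => (holds phi V b && all (holds phi V) L)%:R) =
    mean G - mean G * q * c.
  have meanB H1 H2 : mean (fun V => H1 V - H2 V) = mean H1 - mean H2.
    by rewrite /mean -sumrB; apply: eq_bigr => V _; rewrite mulrBr.
  case E: (phi b) => [b'|].
    exists (f b' false); split=> //.
    have b'L := phiL _ _ bbL E; rewrite in_cons negb_or in b'L.
    case/andP: b'L => b'b b'L.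
    have Gb' : forall V, G (b' |: V)%SET = G V.
      apply: G_indep => // y yL; apply/eqP => E'.
      by move: bL; rewrite -(phi_inj _ _ _ (sL _ yL) bbL E' E) yL.
    have := @mean_indep b' (fun V => G V * (b \in V)%:R) (fun c => (~~ c)%:R).
    rewrite Gb1 /= mulr0 add0r mulr1 => <-; last first.
      by move=> V; rewrite Gb' finset.in_setU1 eq_sym (negbTE b'b).
    rewrite -meanB; congr mean; apply/funext => V.
    rewrite /G /holds E; case: (b \in V) => /=; case: (b' \in V) => /=;
      case: all => /=; ring.
  exists 1; split; first by rewrite gerBl.
  rewrite mulr1 -Gb1 -meanB; congr mean; apply/funext => V.
  by rewrite /G /holds E; case: (b \in V) => /=; case: all => /=; ring.
rewrite exprS; apply: (@le_trans _ _ ((1 - q * (1 - q)) * mean G)).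
  have := mulr_ge0 (mulr_ge0 Gge0 q0) (_ : 0 <= c - (1 - q)); rewrite subr_ge0.
  by move=> /(_ cq); lra.
rewrite ler_wpM2l //.
by nra.
Qed.
End RandomSubset.

(** * Uniform subsets of fixed size *)

(** The successive ratios of the terms C(n,j) k^j (n-k)^(n-j) are at least 1
for j < k and at most 1 for j >= k, so the term j = k is the largest. *)
Lemma binomial_mode (n k j : nat) : (k <= n)%N ->
  ('C(n, j) * (k ^ j * (n - k) ^ (n - j)) <=
   'C(n, k) * (k ^ k * (n - k) ^ (n - k)))%N.
Proof.
move=> kn.
set t := fun j : nat => ('C(n, j) * (k ^ j * (n - k) ^ (n - j)))%N.
have step l : (l < n)%N ->
    (t l.+1 * (l.+1 * (n - k)) = t l * ((n - l) * k))%N.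
  move=> ln; rewrite /t; have := mul_bin_left n l.
  rewrite -[(n - l)%N]prednK ?subn_gt0 // -subnS expnS expnS => e.
  set u := (k ^ l)%N; set v := ((n - k) ^ (n - l.+1))%N.
  have -> : ('C(n, l.+1) * (k * u * v) * (l.+1 * (n - k)) =
    (l.+1 * 'C(n, l.+1)) * (u * v * k * (n - k)))%N by ring.
  rewrite e; ring.
have up l : (l < k)%N -> (t l <= t l.+1)%N.
  move=> lk; have ln := leq_trans lk kn.
  have pos : (0 < (n - l) * k)%N by rewrite muln_gt0 subn_gt0 ln (leq_ltn_trans _ lk).
  rewrite -(leq_pmul2r pos) -step // leq_mul2l; apply/orP; right.
  nia.
have down l : (k <= l)%N -> (l < n)%N -> (t l.+1 <= t l)%N.
  move=> kl ln.
  have pos : (0 < l.+1 * (n - k))%N by rewrite muln_gt0 subn_gt0 /= (leq_ltn_trans kl).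
  rewrite -(leq_pmul2r pos) step // leq_mul2l; apply/orP; right.
  nia.
rewrite -/(t j) -/(t k).
have [jk|kj] := leqP j k.
  have H : forall e, (e <= k)%N -> (t (k - e) <= t k)%N.
    elim=> [|e IH] ek; first by rewrite subn0.
    apply: leq_trans (IH (ltnW ek)).
    have -> : (k - e = (k - e.+1).+1)%N by lia.
    by apply: up; lia.
  by have := H (k - j)%N (leq_subr _ _); rewrite subKn.
have [jn|nj] := leqP j n; last by rewrite {1}/t bin_small.
have H : forall e, (k + e <= n)%N -> (t (k + e) <= t k)%N.
  elim=> [|e IH] ek; first by rewrite addn0.
  apply: leq_trans (IH _); last by lia.
  by rewrite addnS; apply: down; lia.
by have := H (j - k)%N; rewrite subnKC ?(ltnW kj) //; apply.
Qed.

(** The terms of the binomial expansion of (k + (n - k))^n are n + 1 in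
number, and the k-th is the largest. *)
Lemma binomial_mode_ge (n k : nat) : (k <= n)%N ->
  (n ^ n <= n.+1 * ('C(n, k) * (k ^ k * (n - k) ^ (n - k))))%N.
Proof.
move=> kn.
have {1}-> : (n ^ n = \sum_(i < n.+1) 'C(n, i) * (k ^ i * (n - k) ^ (n - i)))%N.
  rewrite -{1}(subnK kn) expnDn; apply: eq_bigr => i _.
  by rewrite [((n - k) ^ _ * _)%N]mulnC.
rewrite -[n.+1 in X in (_ <= X)%N]card_ord -sum_nat_const.
by apply: leq_sum => i _; apply: binomial_mode.
Qed.

(** A given k-subset of n points is at most n + 1 times more likely under the
uniform law on k-subsets than under independent choices with probability q =
k/n: all k-subsets are equally likely under the latter, and k is the most
likely size. *)
Lemma uniform_le_bernoulli (R : realType) (n k : nat) (q : R) :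
  (0 < n)%N -> (k <= n)%N -> q * n%:R = k%:R ->
  ('C(n, k)%:R)^-1 <= n.+1%:R * (q ^+ k * (1 - q) ^+ (n - k)).
Proof.
move=> n0 kn qE.
have nR : (n%:R : R) != 0 by rewrite pnatr_eq0 -lt0n.
have C0 : 0 < ('C(n, k)%:R : R) by rewrite ltr0n bin_gt0.
have -> : q = k%:R / n%:R by rewrite -qE mulfK.
have -> : 1 - k%:R / n%:R = (n - k)%:R / n%:R :> R.
  by rewrite natrB // mulrBl divff.
rewrite -(ler_pM2l C0) divff ?gt_eqF //.
rewrite !expr_div_n.
have -> : 'C(n, k)%:R * (n.+1%:R * (k%:R ^+ k / n%:R ^+ k *
    ((n - k)%:R ^+ (n - k) / n%:R ^+ (n - k)))) =
   (n.+1 * ('C(n, k) * (k ^ k * (n - k) ^ (n - k))))%:R / n%:R ^+ n :> R.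
  have -> : (n%:R : R) ^+ n = n%:R ^+ k * n%:R ^+ (n - k).
    by rewrite -exprD subnKC.
  rewrite !natrM !natrX invfM; ring.
rewrite ler_pdivlMr ?exprn_gt0 ?ltr0n // mul1r -natrX ler_nat.
exact: binomial_mode_ge.
Qed.

(** * Subdivision of dyadic cubes *)

Lemma parent1_subproof (m n : nat) (b : 'I_(2 ^ n)) :
  (b %/ 2 ^ (n - m) < 2 ^ m)%N.
Proof.
rewrite ltn_divLR ?expn_gt0 // -expnD (leq_trans (ltn_ord b)) //.
by rewrite leq_exp2l //; lia.
Qed.

Definition parent1 (m n : nat) (b : 'I_(2 ^ n)) : 'I_(2 ^ m) :=
  Ordinal (parent1_subproof m b).

Definition parent (m n : nat) (B : dcube n) : dcube m :=
  (parent1 m B.1.1, parent1 m B.1.2, parent1 m B.2).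

Lemma mem_subcubes (m n : nat) (Q : dcube m) (B : dcube n) :
  (B \in subcubes n Q) = (parent m B == Q).
Proof. by rewrite inE /parent; case: Q => [[q1 q2] q3]; rewrite !xpair_eqE andbA. Qed.

Lemma parent_parent (k m n : nat) (B : dcube n) : (k <= m)%N -> (m <= n)%N ->
  parent k (parent m B) = parent k B.
Proof.
move=> km mn; rewrite /parent /=.
have H (b : 'I_(2 ^ n)) : parent1 k (parent1 m b) = parent1 k b.
  apply: val_inj => /=; rewrite -divnMA -expnD; congr (_ %/ 2 ^ _)%N; lia.
by rewrite !H.
Qed.

Definition children1 (m n : nat) (a : 'I_(2 ^ m)) : {set 'I_(2 ^ n)} :=
  [set b | parent1 m b == a]%SET.

(** The multiples of 2^c in the block of a; the values c = 0 and c = 1 are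
used. *)
Lemma children1_ge (m n c : nat) (a : 'I_(2 ^ m)) : (m + c <= n)%N ->
  (2 ^ (n - m - c) <= #|[set b in children1 n a | 2 ^ c %| b]%SET|)%N.
Proof.
move=> mn.
have e : (2 ^ (n - m - c) * 2 ^ c = 2 ^ (n - m))%N.
  by rewrite -expnD; congr (2 ^ _)%N; lia.
have e2 : (2 ^ m * 2 ^ (n - m) = 2 ^ n)%N.
  by rewrite -expnD; congr (2 ^ _)%N; lia.
have xP (x : 'I_(2 ^ (n - m - c))) : (x * 2 ^ c < 2 ^ (n - m))%N.
  by rewrite -e ltn_pmul2r ?expn_gt0.
have bP (x : 'I_(2 ^ (n - m - c))) : (a * 2 ^ (n - m) + x * 2 ^ c < 2 ^ n)%N.
  apply: (@leq_trans (a.+1 * 2 ^ (n - m))); first by rewrite mulSn addnC ltn_add2r.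
  by rewrite -e2 leq_mul2r ltn_ord orbT.
pose f x : 'I_(2 ^ n) := Ordinal (bP x).
have f_inj : injective f.
  move=> x y /(congr1 val) /= /addnI /eqP.
  by rewrite eqn_pmul2r ?expn_gt0 // => /eqP /val_inj.
rewrite -{1}[(2 ^ (n - m - c))%N]card_ord -cardsT -(card_imset _ f_inj).
apply/subset_leq_card/fintype.subsetP => _ /imsetP[x _ ->].
rewrite !inE; apply/andP; split.
  apply/eqP/val_inj => /=.
  by rewrite divnMDl ?expn_gt0 // divn_small ?addn0.
by apply: dvdn_add; rewrite /= ?dvdn_mull // -e dvdn_mull.
Qed.

Lemma card_children1 (m n : nat) (a : 'I_(2 ^ m)) : (m <= n)%N ->
  #|children1 n a| = (2 ^ (n - m))%N.
Proof.
move=> mn; apply/eqP.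
rewrite eqn_leq; apply/andP; split; last first.
  have := @children1_ge m n 0 a; rewrite addn0 subn0 => /(_ mn) /leq_trans; apply.
  by apply/subset_leq_card/fintype.subsetP => x; rewrite inE => /andP[].
have rP (b : 'I_(2 ^ n)) : (b %% 2 ^ (n - m) < 2 ^ (n - m))%N.
  by rewrite ltn_mod expn_gt0.
pose r b : 'I_(2 ^ (n - m)) := Ordinal (rP b).
rewrite -(@card_in_imset _ _ r); last first.
  move=> b b'; rewrite !inE => /eqP <- /eqP/(congr1 val) /= ee /(congr1 val) /= rr.
  by apply: val_inj; rewrite /= (divn_eq b (2 ^ (n - m))) -ee rr -divn_eq.
by rewrite -[X in (_ <= X)%N]card_ord max_card.
Qed.

Lemma subcubesE (m n : nat) (Q : dcube m) : subcubes n Q =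
  finset.setX (finset.setX (children1 n Q.1.1) (children1 n Q.1.2)) (children1 n Q.2).
Proof.
apply/setP => -[[b1 b2] b3]; rewrite !inE /= -!val_eqE /= andbA //.
Qed.

Lemma card_subcubes (m n : nat) (Q : dcube m) : (m <= n)%N ->
  #|subcubes n Q| = (8 ^ (n - m))%N.
Proof.
move=> mn; rewrite subcubesE !cardsX !card_children1 //.
by rewrite -!expnMn.
Qed.

(** Centers of distinct cubes of this family are at distance at least two
sides, which exceeds the diameter of a cube. *)
Definition even_subcubes (m n : nat) (Q : dcube m) : {set dcube n} :=
  [set B in subcubes n Q | [&& 2 %| B.1.1, 2 %| B.1.2 & 2 %| B.2]%N]%SET.

Lemma card_even_subcubes (m n : nat) (Q : dcube m) : (m < n)%N ->
  (8 ^ (n - m).-1 <= #|even_subcubes n Q|)%N.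
Proof.
move=> mn.
pose E (a : 'I_(2 ^ m)) := [set b in children1 n a | (2 ^ 1 %| b)%N]%SET.
have -> : even_subcubes n Q = finset.setX (finset.setX (E Q.1.1) (E Q.1.2)) (E Q.2).
  apply/setP => -[[b1 b2] b3]; rewrite /even_subcubes subcubesE !inE /= expn1.
  by do 3![case: (_ == _) => //=]; do 3![case: (_ %| _)%N => //=].
have H a : (2 ^ (n - m).-1 <= #|E a|)%N.
  by rewrite -subn1; apply: children1_ge; rewrite addn1.
by rewrite !cardsX -[8%N]/(2 * 2 * 2)%N !expnMn !leq_mul.
Qed.

(** * Isometries of space and their discretization *)

Definition unit_cube (R : realType) : set (space3 R) :=
  [set x | 0 <= x.1.1 <= 1 /\ 0 <= x.1.2 <= 1 /\ 0 <= x.2 <= 1].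

Definition near3 (R : realType) (e : R) (x y : space3 R) : Prop :=
  `|x.1.1 - y.1.1| <= e /\ `|x.1.2 - y.1.2| <= e /\ `|x.2 - y.2| <= e.

Definition sqdist (R : realType) (x y : space3 R) : R :=
  (x.1.1 - y.1.1) ^+ 2 + (x.1.2 - y.1.2) ^+ 2 + (x.2 - y.2) ^+ 2.

Definition combine (R : realType) (o u v w x : space3 R) : space3 R :=
  (o.1.1 + x.1.1 * u.1.1 + x.1.2 * v.1.1 + x.2 * w.1.1,
   o.1.2 + x.1.1 * u.1.2 + x.1.2 * v.1.2 + x.2 * w.1.2,
   o.2 + x.1.1 * u.2 + x.1.2 * v.2 + x.2 * w.2).

Lemma sqdist_isometry (R : realType) (g : space3 R -> space3 R) x y :
  isometry3 g -> sqdist (g x) (g y) = sqdist x y.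
Proof.
move=> [_ /(_ x y)] /eqP; rewrite /edist eqr_sqrt ?addr_ge0 ?sqr_ge0 //.
by move=> /eqP.
Qed.

Lemma sqr3_eq0 (R : realType) (a b c : R) :
  a ^+ 2 + b ^+ 2 + c ^+ 2 = 0 -> [/\ a = 0, b = 0 & c = 0].
Proof.
move=> /eqP; rewrite !paddr_eq0 ?addr_ge0 ?sqr_ge0 // !sqrf_eq0.
by move=> /andP[/andP[/eqP-> /eqP->] /eqP->].
Qed.

Lemma sqr_le1 (R : realType) (a b c : R) :
  a ^+ 2 + b ^+ 2 + c ^+ 2 = 1 -> [/\ -1 <= a <= 1, -1 <= b <= 1 & -1 <= c <= 1].
Proof.
move=> e; have := sqr_ge0 a; have := sqr_ge0 b; have := sqr_ge0 c => *.
by split; rewrite -ler_norml -(@expr_le1 _ 2) // real_normK ?num_real //; lra.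
Qed.

(** Inner products are determined by distances, so the images of the basis
vectors, taken relative to the image of the origin, are orthonormal, and the
vector from g 0 to g x has the same coordinates in that system as x has in
the standard basis. Indeed the squared norm of the difference of the two
sides expands into inner products that are all known. *)
Lemma isometry_affine (R : realType) (g : space3 R -> space3 R) :
  isometry3 g -> exists u v w : space3 R,
  [/\ forall x, g x = combine (g (0, 0, 0)) u v w x,
      near3 1 u (0, 0, 0), near3 1 v (0, 0, 0) & near3 1 w (0, 0, 0)].
Proof.
move=> giso.
pose sub (x y : space3 R) : space3 R := (x.1.1 - y.1.1, x.1.2 - y.1.2, x.2 - y.2).
pose dot (x y : space3 R) : R := x.1.1 * y.1.1 + x.1.2 * y.1.2 + x.2 * y.2.
pose o := g (0, 0, 0).
pose h x := sub (g x) o.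
(* By polarization, distances determine inner products. *)
have dotE x y : dot (h x) (h y) = dot x y.
  have := sqdist_isometry x y giso.
  have := sqdist_isometry x (0, 0, 0) giso.
  have := sqdist_isometry y (0, 0, 0) giso.
  rewrite -/o /sqdist /dot /h /sub /=.
  set a := g x; set b := g y; move=> e1 e2 e3.
  have two0 : (2 : R) != 0 by rewrite pnatr_eq0.
  apply: (mulfI two0); lra.
pose u := h (1, 0, 0); pose v := h (0, 1, 0); pose w := h (0, 0, 1).
have norm1 z : dot z z = 1 -> near3 1 z (0, 0, 0).
  rewrite /dot -!expr2 => /sqr_le1 [a1 a2 a3].
  by rewrite /near3 /= !subr0 !ler_norml.
exists u, v, w; split; last 3 first.
- by apply: norm1; rewrite dotE /dot /=; ring.
- by apply: norm1; rewrite dotE /dot /=; ring.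
- by apply: norm1; rewrite dotE /dot /=; ring.
move=> x.
pose z := sub (g x) (combine o u v w x).
have z0 : z.1.1 ^+ 2 + z.1.2 ^+ 2 + z.2 ^+ 2 = 0.
  transitivity (dot (h x) (h x)
    - 2 * (x.1.1 * dot (h x) u + x.1.2 * dot (h x) v + x.2 * dot (h x) w)
    + (x.1.1 ^+ 2 * dot u u + x.1.2 ^+ 2 * dot v v + x.2 ^+ 2 * dot w w)
    + 2 * (x.1.1 * x.1.2 * dot u v + x.1.1 * x.2 * dot u w
           + x.1.2 * x.2 * dot v w)).
    by rewrite /z /dot /combine /h /sub /=; ring.
  by rewrite !dotE /dot /=; ring.
have [] := sqr3_eq0 z0; rewrite /z /sub /= => /subr0_eq e1 /subr0_eq e2 /subr0_eq e3.
by rewrite -/o; move: e1 e2 e3; case: (g x) => [[a b] c] /= -> -> ->.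
Qed.

(** Indices of the 2^(n+9) multiples of 2^-(n+6) in the interval [-4, 4). *)
Definition grid_index (n : nat) : finType := 'I_(2 ^ (n + 9)).

Definition grid (R : realType) (n : nat) (k : grid_index n) : R :=
  k%:R / 2 ^+ (n + 6) - 4.

Lemma grid_dense (R : realType) (n : nat) (t : R) : -4 <= t < 4 ->
  exists k : grid_index n, `|grid R k - t| <= (2 ^+ (n + 6))^-1.
Proof.
move=> /andP[t1 t2].
have P0 : (0 : R) < 2 ^+ (n + 6) by rewrite exprn_gt0.
have a0 : 0 <= (t + 4) * 2 ^+ (n + 6) by rewrite mulr_ge0 ?(ltW P0) //; lra.
have /andP[k1 k2] := Num.Theory.truncn_itv a0.
set k := Num.truncn _ in k1 k2.
have kP : (k < 2 ^ (n + 9))%N.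
  rewrite -(ltr_nat R) (le_lt_trans k1) // natrX.
  rewrite (_ : n + 9 = 3 + (n + 6))%N; last by lia.
  rewrite [X in _ < X]exprD ltr_pM2r //.
  by rewrite (_ : 2 ^+ 3 = 8 :> R); [lra | ring].
exists (Ordinal kP); rewrite /grid /=.
have -> : k%:R / 2 ^+ (n + 6) - 4 - t =
   (k%:R - (t + 4) * 2 ^+ (n + 6)) / 2 ^+ (n + 6).
  by field; rewrite gt_eqF.
rewrite normrM normfV (gtr0_norm P0) ler_pdivrMr // mulVf ?gt_eqF //.
by rewrite ler_norml; move: k2; rewrite -natr1; lra.
Qed.

Definition point_code (n : nat) : finType :=
  (grid_index n * grid_index n * grid_index n)%type.

(** Rounded values of g 0 and of the three columns of the linear part of an
isometry g. *)
Definition code (n : nat) : finType :=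
  (point_code n * point_code n * point_code n * point_code n)%type.

Definition grid_point (R : realType) (n : nat) (k : point_code n) : space3 R :=
  (grid R k.1.1, grid R k.1.2, grid R k.2).

Definition decode (R : realType) (n : nat) (c : code n) : space3 R -> space3 R :=
  combine (grid_point R c.1.1.1) (grid_point R c.1.1.2) (grid_point R c.1.2)
    (grid_point R c.2).

Lemma card_code (n : nat) : #|code n| = (2 ^ (12 * (n + 9)))%N.
Proof.
rewrite /code /point_code /grid_index !card_prod !card_ord.
by rewrite -!expnD; congr (2 ^ _)%N; lia.
Qed.

Lemma grid_point_dense (R : realType) (n : nat) (x : space3 R) :
  near3 3 x (0, 0, 0) ->
  exists k : point_code n, near3 (2 ^+ (n + 6))^-1 (grid_point R k) x.
Proof.
case: x => [[x1 x2] x3] [] /=; rewrite !subr0 => h1 [h2 h3].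
have H (t : R) : `|t| <= 3 -> -4 <= t < 4 by rewrite ler_norml => /andP[]; lra.
have [k1 e1] := grid_dense n (H _ h1).
have [k2 e2] := grid_dense n (H _ h2).
have [k3 e3] := grid_dense n (H _ h3).
by exists (k1, k2, k3).
Qed.

Lemma combine_near (R : realType) (e : R) (o u v w o' u' v' w' x : space3 R) :
  near3 e o' o -> near3 e u' u -> near3 e v' v -> near3 e w' w ->
  unit_cube x -> near3 (4 * e) (combine o' u' v' w' x) (combine o u v w x).
Proof.
move=> [a1 [a2 a3]] [u1 [u2 u3]] [v1 [v2 v3]] [w1 [w2 w3]] [x1 [x2 x3]].
have H (a b c d a' b' c' d' : R) : `|a' - a| <= e -> `|b' - b| <= e ->
  `|c' - c| <= e -> `|d' - d| <= e ->
  `|(a' + x.1.1 * b' + x.1.2 * c' + x.2 * d') -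
    (a + x.1.1 * b + x.1.2 * c + x.2 * d)| <= 4 * e.
  move=> ha hb hc hd.
  have T (t y y' : R) : 0 <= t <= 1 -> `|y' - y| <= e -> `|t * (y' - y)| <= e.
    move=> /andP[t0 t1] hy; rewrite normrM (ger0_norm t0).
    by rewrite (le_trans _ hy) // ler_piMl.
  have := T _ _ _ x1 hb; have := T _ _ _ x2 hc; have := T _ _ _ x3 hd.
  move: ha; rewrite !ler_norml => /andP[l1 r1] /andP[l2 r2] /andP[l3 r3] /andP[l4 r4].
  apply/andP; split; lra.
by split; [|split]; apply: H.
Qed.

(** The translation part is bounded because x0 and g x0 both lie in the unit
cube. A point of the unit cube is then displaced, in each coordinate, by at
most four rounding errors of 2^-(n+6). *)
Lemma isometry_code (R : realType) (n : nat) (g : space3 R -> space3 R) x0 :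
  isometry3 g -> unit_cube x0 -> unit_cube (g x0) ->
  exists c : code n,
    forall x, unit_cube x -> near3 ((2 ^+ n)^-1 / 16) (decode c x) (g x).
Proof.
move=> giso x0P gx0P; have [u [v [w [gE hu hv hw]]]] := isometry_affine giso.
have n13 z : near3 1 z (0, 0, 0) -> near3 (3 : R) z (0, 0, 0).
  by move=> [a1 [a2 a3]]; split; [|split]; apply: (@le_trans _ _ (1 : R)) => //; lra.
have o3 : near3 (3 : R) (g (0, 0, 0)) (0, 0, 0).
  have := sqdist_isometry x0 (0, 0, 0) giso.
  case: x0P gx0P => x1 [x2 x3] [y1 [y2 y3]].
  rewrite /sqdist /= !subr0; set a := g x0; set b := g _ => e.
  have sq (t : R) : 0 <= t <= 1 -> t ^+ 2 <= 1.
    by move=> /andP[t0 t1]; rewrite expr_le1.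
  have s1 := sq _ x1; have s2 := sq _ x2; have s3 := sq _ x3.
  have p1 := sqr_ge0 (a.1.1 - b.1.1); have p2 := sqr_ge0 (a.1.2 - b.1.2).
  have p3 := sqr_ge0 (a.2 - b.2).
  have K (t r : R) : 0 <= t <= 1 -> (t - r) ^+ 2 <= 3 -> `|r - 0| <= 3.
    rewrite subr0 => /andP[t0 t1] h.
    have : `|t - r| <= 2.
      by rewrite ler_norml; apply/andP; split; nra.
    by rewrite !ler_norml => /andP[l5 r5]; apply/andP; split; lra.
  by split; [|split]; [apply: (K _ _ y1)|apply: (K _ _ y2)|apply: (K _ _ y3)]; lra.
have [ko ho] := grid_point_dense n o3.
have [ku hu'] := grid_point_dense n (n13 _ hu).
have [kv hv'] := grid_point_dense n (n13 _ hv).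
have [kw hw'] := grid_point_dense n (n13 _ hw).
exists (ko, ku, kv, kw) => x xP; rewrite gE.
have -> : (2 ^+ n)^-1 / 16 = 4 * (2 ^+ (n + 6))^-1 :> R.
  have P0 : (2 : R) ^+ n != 0 by rewrite expf_neq0 // pnatr_eq0.
  by rewrite exprD; field; rewrite P0 /= ?expf_neq0 ?pnatr_eq0.
exact: combine_near.
Qed.

(** * Dyadic cubes under an isometry *)

Definition center (R : realType) (n : nat) (B : dcube n) : space3 R :=
  ((B.1.1%:R + 2^-1) / 2 ^+ n, (B.1.2%:R + 2^-1) / 2 ^+ n, (B.2%:R + 2^-1) / 2 ^+ n).

Section Axis.
Variables (R : realType) (n : nat).
Let h : R := (2 ^+ n)^-1.

Lemma side_gt0 : 0 < h. Proof. by rewrite invr_gt0 exprn_gt0. Qed.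

Lemma dside_center (b : 'I_(2 ^ n)) (t : R) :
  dside b t <-> `|t - (b%:R + 2^-1) / 2 ^+ n| <= h / 2.
Proof.
have h0 := side_gt0.
rewrite /dside /= -/h ler_norml -natr1; split=> /andP[a1 a2]; apply/andP; split; lra.
Qed.

Lemma dside_unit (b : 'I_(2 ^ n)) (t : R) : dside b t -> 0 <= t <= 1.
Proof.
have h0 := side_gt0.
rewrite /dside /= => /andP[a1 a2]; apply/andP; split.
  by apply: le_trans a1; rewrite divr_ge0 ?exprn_ge0.
apply: (le_trans a2); rewrite ler_pdivrMr ?exprn_gt0 // mul1r -natrX ler_nat.
exact: ltn_ord.
Qed.

Lemma dside_parent (m : nat) (b : 'I_(2 ^ n)) (t : R) : (m <= n)%N ->
  dside b t -> dside (parent1 m b) t.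
Proof.
move=> mn; rewrite /dside /= => /andP[a1 a2].
have e : (2 : R) ^+ n = 2 ^+ (n - m) * 2 ^+ m by rewrite -exprD subnK.
have K (x : R) : x / 2 ^+ m = (x * 2 ^+ (n - m)) / 2 ^+ n.
  by rewrite e; field; rewrite !expf_neq0 ?pnatr_eq0.
rewrite !K; apply/andP; split.
  apply: le_trans a1; rewrite ler_wpM2r ?invr_ge0 ?exprn_ge0 //.
  by rewrite -natrX -natrM ler_nat leq_trunc_div.
apply: (le_trans a2); rewrite ler_wpM2r ?invr_ge0 ?exprn_ge0 //.
rewrite -natrX -natrM ler_nat.
by rewrite [X in (X < _)%N](divn_eq b (2 ^ (n - m))) mulSn addnC ltn_add2r ltn_mod expn_gt0.
Qed.

Lemma dside_interior_inj (b b' : 'I_(2 ^ n)) (t : R) :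
  `|t - (b%:R + 2^-1) / 2 ^+ n| < h / 2 -> dside b' t -> b' = b.
Proof.
have h0 := side_gt0.
rewrite /dside /= -/h ltr_norml => /andP[a1 a2] /andP[a3 a4].
have l1 : b%:R * h < b'.+1%:R * h by lra.
have l2 : b'%:R * h < b.+1%:R * h by move: a2; rewrite -(natr1 b); lra.
rewrite !ltr_pM2r // !ltr_nat in l1 l2.
by apply: val_inj; apply/eqP; rewrite eqn_leq -ltnS l2 -ltnS l1.
Qed.

(** A slight move towards the center reaches the interior. *)
Lemma dside_shrink (b : 'I_(2 ^ n)) (t : R) : dside b t -> exists t' : R,
  `|t' - t| <= h / 16 /\ `|t' - (b%:R + 2^-1) / 2 ^+ n| < h / 2.
Proof.
have h0 := side_gt0.
move/dside_center; set c := (_ + _) / _ => tc.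
exists (t + (c - t) / 8); split.
  have -> : t + (c - t) / 8 - t = - ((t - c) / 8) by ring.
  by rewrite normrN normrM (@ger0_norm _ 8^-1) ?invr_ge0 //; lra.
have -> : t + (c - t) / 8 - c = (t - c) * (7 / 8) by field.
by rewrite normrM (@ger0_norm _ (7 / 8)); lra.
Qed.

Lemma even_center_far (b b' : 'I_(2 ^ n)) : (2 %| b)%N -> (2 %| b')%N -> b != b' ->
  4 * h ^+ 2 <= ((b%:R + 2^-1) / 2 ^+ n - (b'%:R + 2^-1) / 2 ^+ n) ^+ 2.
Proof.
move=> eb eb' bb'; rewrite -/h -mulrBl exprMn ler_wpM2r ?sqr_ge0 //.
have -> : b%:R + 2^-1 - (b'%:R + 2^-1) = b%:R - b'%:R :> R by ring.
have [lt|lt|eq] := ltngtP b b'; last by case/eqP: bb'; apply: val_inj.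
- have : (b.+2 <= b')%N by move: (dvdnP eb) (dvdnP eb') => -[x e1] [y e2]; lia.
  rewrite -(ler_nat R) -2!natr1 => l.
  by rewrite expr2; nra.
- have : (b'.+2 <= b)%N by move: (dvdnP eb) (dvdnP eb') => -[x e1] [y e2]; lia.
  rewrite -(ler_nat R) -2!natr1 => l.
  by rewrite expr2; nra.
Qed.
End Axis.

Section Cells.
Variables (R : realType) (n : nat).
Let h : R := (2 ^+ n)^-1.
Implicit Types (B : dcube n) (x y : space3 R).

Lemma cube_center B x : cube B x <-> near3 (h / 2) x (center R B).
Proof. by rewrite /cube /near3 /= -!dside_center. Qed.

Lemma center_in_cube B : cube B (center R B).
Proof.
have h0 : 0 <= h / 2 by rewrite divr_ge0 ?ltW ?side_gt0.
by apply/cube_center; rewrite /near3 !subrr normr0.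
Qed.

Lemma cube_unit B x : cube B x -> unit_cube x.
Proof. by move=> [a [b c]]; split; [|split]; apply: dside_unit; eassumption. Qed.

Lemma cube_parent (m : nat) B x : (m <= n)%N -> cube B x -> cube (parent m B) x.
Proof. by move=> mn [a [b c]]; split; [|split]; apply: dside_parent. Qed.

(** The point y may lie on faces shared by several cubes; a nearby interior
point of B belongs to B alone. *)
Lemma cube_interior B y : cube B y -> exists2 y', near3 (h / 16) y' y &
  forall B', cube B' y' -> B' = B.
Proof.
case: B => [[b1 b2] b3]; case: y => [[y1 y2] y3] [].
move=> /dside_shrink[z1 [e1 f1]] [] /dside_shrink[z2 [e2 f2]] /dside_shrink[z3 [e3 f3]].
exists (z1, z2, z3) => //= -[[c1 c2] c3] [/= g1 [g2 g3]].
by rewrite (dside_interior_inj f1 g1) (dside_interior_inj f2 g2)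
  (dside_interior_inj f3 g3).
Qed.

(** The preimage is as far from the center of B as y is from its image, and
this is less than half a side. *)
Lemma preimage_in_cube (g : space3 R -> space3 R) B y :
  isometry3 g -> near3 (h / 4) y (g (center R B)) -> exists2 z, cube B z & g z = y.
Proof.
move=> giso [y1 [y2 y3]]; have [[f gf fg] _] := giso.
exists (f y) => //; apply/cube_center.
have := sqdist_isometry (f y) (center R B) giso; rewrite fg.
set z := f y; set c := center R B; rewrite /sqdist.
have h0 : 0 < h by exact: side_gt0.
have sq (t : R) : `|t| <= h / 4 -> t ^+ 2 <= h ^+ 2 / 16.
  rewrite ler_norml => /andP[l r].
  have -> : h ^+ 2 / 16 = (h / 4) ^+ 2 by field.
  have : 0 <= (h / 4 - t) * (h / 4 + t) by apply: mulr_ge0; lra.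
  by move=> pos; rewrite !expr2; lra.
have := sq _ y1; have := sq _ y2; have := sq _ y3.
have := sqr_ge0 (z.1.1 - c.1.1); have := sqr_ge0 (z.1.2 - c.1.2).
have := sqr_ge0 (z.2 - c.2) => p3 p2 p1 q3 q2 q1 e.
have K (t : R) : t ^+ 2 <= (h / 2) ^+ 2 -> `|t| <= h / 2.
  rewrite !expr2 => tt; rewrite ler_norml; apply/andP; split; nra.
have hh : (h / 2) ^+ 2 = h ^+ 2 / 4 by field.
by split; [|split]; apply: K; rewrite hh; lra.
Qed.

(** Otherwise the centers of B1 and B2 are at least two sides apart, and so
are their images; but these images are close to points of a single cube,
whose diameter is less than two sides. *)
Lemma even_image_sep (g : space3 R -> space3 R) (m : nat) (Q : dcube m)
    B1 B2 B y1 y2 :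
  isometry3 g -> B1 \in even_subcubes n Q -> B2 \in even_subcubes n Q ->
  near3 (h / 16) y1 (g (center R B1)) -> near3 (h / 16) y2 (g (center R B2)) ->
  cube B y1 -> cube B y2 -> B1 = B2.
Proof.
move=> giso; rewrite !inE => /andP[_ /and3P[e11 e12 e13]].
move=> /andP[_ /and3P[e21 e22 e23]].
move=> [n11 [n12 n13]] [n21 [n22 n23]] /cube_center[c11 [c12 c13]].
move=> /cube_center[c21 [c22 c23]].
have h0 : 0 < h by exact: side_gt0.
set g1 := g (center R B1) in n11 n12 n13.
set g2 := g (center R B2) in n21 n22 n23.
have up : sqdist g1 g2 < 4 * h ^+ 2.
  have D (a b a' b' c : R) : `|a' - a| <= h / 16 -> `|b' - b| <= h / 16 ->
    `|a' - c| <= h / 2 -> `|b' - c| <= h / 2 -> (a - b) ^+ 2 <= (h * (9 / 8)) ^+ 2.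
    rewrite !ler_norml => /andP[l1 r1] /andP[l2 r2] /andP[l3 r3] /andP[l4 r4].
    have : 0 <= (h * (9 / 8) - (a - b)) * (h * (9 / 8) + (a - b)).
      by apply: mulr_ge0; lra.
    by move=> pos; rewrite !expr2; lra.
  have d1 := D _ _ _ _ _ n11 n21 c11 c21.
  have d2 := D _ _ _ _ _ n12 n22 c12 c22.
  have d3 := D _ _ _ _ _ n13 n23 c13 c23.
  rewrite /sqdist; have -> : 4 * h ^+ 2 = (h * (9 / 8)) ^+ 2 * (256 / 81) by field.
  have : 0 < (h * (9 / 8)) ^+ 2 by rewrite exprn_gt0 // mulr_gt0 //; lra.
  lra.
move: up; rewrite sqdist_isometry // /sqdist /=.
set d1 := _ ^+ 2; set d2 := _ ^+ 2; set d3 := _ ^+ 2 => up.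
have p1 : 0 <= d1 by exact: sqr_ge0.
have p2 : 0 <= d2 by exact: sqr_ge0.
have p3 : 0 <= d3 by exact: sqr_ge0.
have E (b b' : 'I_(2 ^ n)) : (2 %| b)%N -> (2 %| b')%N ->
   ((b%:R + 2^-1) / 2 ^+ n - (b'%:R + 2^-1) / 2 ^+ n) ^+ 2 < 4 * h ^+ 2 -> b = b'.
  move=> eb eb' lt; apply/eqP; apply: contraTT lt => bb'.
  by rewrite -leNgt; apply: even_center_far.
case: B1 B2 @d1 @d2 @d3 up p1 p2 p3 e11 e12 e13 e21 e22 e23
  {n11 n12 n13 n21 n22 n23 g1 g2} => [[a1 a2] a3] [[b1 b2] b3] /=.
move=> up p1 p2 p3 e11 e12 e13 e21 e22 e23.
congr (_, _, _); apply: E => //; lra.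
Qed.

(** The pick makes an arbitrary choice when the image of the center lies on a
common face of several cubes; it is None when that image leaves the unit
cube. *)
Definition cell_image (c : code n) B : option (dcube n) :=
  [pick B' | `[< cube B' (decode c (center R B)) >]].

(** The pairs (b, phi b) with b in L are pairwise disjoint. *)
Definition admissible (T : finType) (phi : T -> option T) (L : {set T}) : Prop :=
  (forall b b', b \in L -> phi b = Some b' -> b' \notin L) /\
  (forall b1 b2 b', b1 \in L -> b2 \in L ->
     phi b1 = Some b' -> phi b2 = Some b' -> b1 = b2).

(** The code c is obtained by rounding g. The decoded image y of the center
of an even cube B is so close to its image under g that y = g z for some z in
B. Hence y is outside A, since g maps A off A; and if B belongs to V, then y
is in the complex. In the latter case the cube picked by cell_image is itself
in V, because the argument applies equally to an interior point of that cube
near y. *)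
Lemma subcongruence_code (S m : nat) (A : dcube S) (Q : dcube m)
    (V : {set dcube n}) B0 (g : space3 R -> space3 R) :
  (S <= m)%N -> (m <= n)%N -> parent S Q = A -> B0 \in V -> parent S B0 = A ->
  isometry3 g -> cube A `&` g @` cube A = set0 ->
  g @` (cube A `&` dcomplex V) `<=` dcomplex V ->
  exists2 c : code n, admissible (cell_image c) (even_subcubes n Q) &
    forall B, B \in even_subcubes n Q -> holds (cell_image c) V B.
Proof.
move=> Sm mn QA B0V B0A giso disj sub.
have Sn := leq_trans Sm mn.
have inA B x : parent S B = A -> cube B x -> cube A x.
  by move=> <-; apply: cube_parent.
have inK B x : B \in V -> cube B x -> dcomplex V x by exists B.
have h0 : 0 < h by exact: side_gt0.
have evenA B : B \in even_subcubes n Q -> parent S B = A.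
  by rewrite inE mem_subcubes => /andP[/eqP e _]; rewrite -QA -e parent_parent.
have [c cP] : exists c : code n,
    forall x, unit_cube x -> near3 (h / 16) (decode c x) (g x).
  apply: (@isometry_code _ _ _ (center R B0)) => //.
    exact/cube_unit/center_in_cube.
  have [|B _] := sub (g (center R B0)); last exact: cube_unit.
  exists (center R B0) => //; split.
    exact: inA B0A (center_in_cube _).
  exact: inK B0V (center_in_cube _).
have cB B : near3 (h / 16) (decode c (center R B)) (g (center R B)).
  by apply: cP; exact/cube_unit/center_in_cube.
have near_le (e e' : R) x y : e <= e' -> near3 e x y -> near3 e' x y.
  by move=> ee [l1 [l2 l3]]; split; [|split]; apply: le_trans ee.
have tri (a b d : R) : `|a - b| <= h / 16 -> `|b - d| <= h / 16 -> `|a - d| <= h / 4.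
  by rewrite !ler_norml => /andP[l1 r1] /andP[l2 r2]; apply/andP; split; lra.
have imgP B B' : cell_image c B = Some B' -> cube B' (decode c (center R B)).
  by rewrite /cell_image; case: pickP => // B'' /asboolP ? [<-].
exists c; first split.
- move=> B B' BL /imgP hB'; apply/negP => /evenA B'A.
  have nB : near3 (h / 4) (decode c (center R B)) (g (center R B)).
    by apply: near_le (cB B); lra.
  have [z zB gz] := preimage_in_cube giso nB.
  suff : (cube A `&` g @` cube A) (decode c (center R B)) by rewrite disj.
  split; first exact: inA B'A hB'.
  by exists z => //; apply: inA zB; apply: evenA.
- move=> B1 B2 B' B1L B2L /imgP h1 /imgP h2.
  exact: (even_image_sep giso B1L B2L (cB B1) (cB B2) h1 h2).
- move=> B BL; apply/implyP => BV.
  have hit y : near3 (h / 4) y (g (center R B)) -> exists2 B', B' \in V & cube B' y.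
    move=> yP; have [z zB <-] := preimage_in_cube giso yP.
    apply: sub; exists z => //; split; last exact: inK zB.
    by apply: inA zB; apply: evenA.
  have [|B1 B1V hB1] := hit (decode c (center R B)).
    by apply: near_le (cB B); lra.
  rewrite /cell_image; case: pickP => [B' /asboolP hB'|/(_ B1) /asboolP //].
  have [y' yy' uniq_y'] := cube_interior hB'.
  have [|B2 B2V /uniq_y' <- //] := hit y'.
  case: (cB B) yy' => l1 [l2 l3] [k1 [k2 k3]].
  by split; [|split]; [exact: tri k1 l1|exact: tri k2 l2|exact: tri k3 l3].
Qed.
End Cells.

(** * Intersections of dyadic cubes of measure zero *)

Section MeasureZero.
Variable R : realType.

Lemma dside_itv (n : nat) (a : 'I_(2 ^ n)) :
  @dside R n a = `[a%:R / 2 ^+ n, a.+1%:R / 2 ^+ n]%classic.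
Proof. by apply/seteqP; split=> t; rewrite /dside /= in_itv. Qed.

Lemma measurable_dside (n : nat) (a : 'I_(2 ^ n)) : measurable (@dside R n a).
Proof. by rewrite dside_itv; exact: measurable_itv. Qed.

(** Dyadic intervals that are not nested share at most an endpoint. *)
Lemma dside_overlap_null (m n : nat) (a : 'I_(2 ^ m)) (b : 'I_(2 ^ n)) :
  (m <= n)%N -> parent1 m b != a ->
  @lebesgue_measure R (@dside R m a `&` @dside R n b) = 0%E.
Proof.
move=> mn ba.
have meas : measurable (@dside R m a `&` @dside R n b).
  by apply: measurableI; exact: measurable_dside.
suff [c sub] : exists c : R, @dside R m a `&` @dside R n b `<=` [set c].
  apply/eqP; rewrite eq_le measure_ge0 andbT.
  by rewrite -(lebesgue_measure_set1 c) le_measure ?inE //; exact: measurable_set1.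
set c := parent1 m b in ba.
have [lt|lt|/val_inj e] := ltngtP c a; last by rewrite e eqxx in ba.
  exists (a%:R / 2 ^+ m) => t /= [ta /(dside_parent mn)].
  move: ta; rewrite /dside /= -/c => /andP[t1 t2] /andP[t3 t4].
  apply/eqP; rewrite eq_le t1 andbT (le_trans t4) //.
  by rewrite ler_wpM2r ?invr_ge0 ?exprn_ge0 // ler_nat.
exists (c%:R / 2 ^+ m) => t /= [ta /(dside_parent mn)].
move: ta; rewrite /dside /= -/c => /andP[t1 t2] /andP[t3 t4].
apply/eqP; rewrite eq_le t3 andbT (le_trans t2) //.
by rewrite ler_wpM2r ?invr_ge0 ?exprn_ge0 // ler_nat.
Qed.

Lemma cube_setX (n : nat) (Q : dcube n) :
  @cube R n Q = dside Q.1.1 `*` dside Q.1.2 `*` dside Q.2.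
Proof.
by apply/seteqP; split=> [x [a [b c]]|x [[a b] c]]; split => //; split.
Qed.

Lemma cube_overlap_null (m n : nat) (A : dcube m) (B : dcube n) :
  (m <= n)%N -> parent m B != A -> lebesgue3 (@cube R m A `&` @cube R n B) = 0%E.
Proof.
move=> mn; rewrite /lebesgue3 !cube_setX -!setXI.
have meas i j (a : 'I_(2 ^ i)) (b : 'I_(2 ^ j)) : measurable (@dside R i a `&` @dside R j b).
  by apply: measurableI; exact: measurable_dside.
rewrite product_measure1E; [|by apply: measurableX; apply: meas|exact: meas].
rewrite /= product_measure1E; [|exact: meas|exact: meas].
case: A B => [[a1 a2] a3] [[b1 b2] b3]; rewrite /parent /= !xpair_eqE !negb_and.
by move=> /orP[/orP[]|] /(dside_overlap_null mn) ->; rewrite ?mul0e ?mule0 ?mul0e.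
Qed.

(** Cubes of V that do not lie in A meet A in a subset of a face, so they
contribute nothing to the measure. *)
Lemma positive_measure_cell (m n : nat) (A : dcube m) (V : {set dcube n}) :
  (m <= n)%N -> (0 < lebesgue3 (@cube R m A `&` dcomplex V))%E ->
  exists2 B, B \in V & parent m B = A.
Proof.
move=> mn; apply: contraPP => noB.
have null (B : dcube n) : B \in V -> lebesgue3 (@cube R m A `&` @cube R n B) = 0%E.
  move=> BV; apply: cube_overlap_null => //.
  by apply/eqP => e; apply: noB; exists B.
have mcube k (Q : dcube k) : measurable (@cube R k Q).
  by rewrite cube_setX; do 2?[apply: measurableX]; exact: measurable_dside.
have -> : @cube R m A `&` dcomplex V =
    \big[setU/set0]_(B <- enum V) (@cube R m A `&` @cube R n B).
  rewrite -bigcup_seq; apply/seteqP; split=> x.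
    by move=> [xA [B BV xB]]; exists B => //=; rewrite mem_enum.
  by move=> [B /=]; rewrite mem_enum => BV [xA xB]; split => //; exists B.
apply/negP; rewrite -leNgt.
have K : forall s : seq (dcube n), {subset s <= V} ->
    (lebesgue3 (\big[setU/set0]_(B <- s) (@cube R m A `&` @cube R n B)) <= 0)%E.
  elim=> [|B s IH] sV; first by rewrite big_nil /lebesgue3 measure0.
  rewrite big_cons.
  apply: le_trans (_ : _ <= lebesgue3 (@cube R m A `&` @cube R n B) +
    lebesgue3 (\big[setU/set0]_(B <- s) (@cube R m A `&` @cube R n B)))%E _.
    rewrite /lebesgue3; apply: measureU2; first by apply: measurableI; apply: mcube.
    by apply: bigsetU_measurable => i _; apply: measurableI; apply: mcube.
  rewrite null ?add0e; last by apply: sV; rewrite mem_head.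
  by apply: IH => y ys; apply: sV; rewrite in_cons ys orbT.
by apply: K => y; rewrite mem_enum.
Qed.
End MeasureZero.

(** * Numerical estimates *)

(** Since s is exponential in M, the factor (8/5)^s absorbs all the exponents
that are linear in M, and the polynomial in s on the left is smaller than
5^s. *)
Lemma exponent_bound (M s : nat) : (2 <= M)%N -> (3 * 8 ^ M <= s)%N ->
  (3 * M + 12 * (M + s + 9) + (3 * s + 1) * 8 ^ M + 5 ^ (M + s) <
   8 ^ (s - 1 - 2 * M))%N.
Proof.
move=> M2 Ms.
have growth : (9 * M + 6 <= 8 ^ M)%N.
  elim: M M2 {Ms} => // -[|[|M]] IH _ //.
  have := IH isT; rewrite [(8 ^ M.+3)%N]expnS; lia.
have M64 : (64 <= 8 ^ M)%N by rewrite (@leq_pexp2l 8 2).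
have poly : (3 * M + 12 * (M + s + 9) + (3 * s + 1) * 8 ^ M <= 5 ^ (M + s))%N.
  apply: (@leq_trans (5 ^ s)); last by rewrite leq_exp2l // leq_addl.
  apply: (@leq_trans (4 * s * s)).
    move: (8 ^ M)%N growth M64 Ms => E growth M64 Ms.
    have h1 : (3 * s * E <= s * s)%N.
      by rewrite [(3 * s)%N]mulnC -mulnA leq_mul2l Ms orbT.
    have h2 : (192 * s <= s * s)%N by rewrite leq_mul2r; apply/orP; right; lia.
    lia.
  elim: s {Ms} => // -[|s] // IH.
  rewrite expnS; apply: leq_trans (leq_mul (leqnn 5) IH); nia.
have main : (2 * 5 ^ (M + s) < 8 ^ (s - 1 - 2 * M))%N.
  have H t : ((2 * 5 ^ 2) ^ t <= (8 ^ 2) ^ t)%N by case: t => // t; rewrite leq_exp2r.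
  set t := (s %/ 2)%N.
  have tP : (9 * M + 6 <= t)%N by rewrite leq_divRL //; lia.
  have st : (2 ^ t * 5 ^ s <= 8 ^ s)%N.
    rewrite {1 2}(divn_eq s 2) -/t !expnD mulnA.
    apply: leq_mul; last by case: (s %% 2)%N => // r; rewrite leq_exp2r.
    by have := H t; rewrite expnMn -!expnM [(2 * t)%N]mulnC.
  have e1 : (8 ^ s = 8 ^ (s - 1 - 2 * M) * 8 ^ (1 + 2 * M))%N.
    by rewrite -expnD; congr (8 ^ _)%N; lia.
  have P0 : (0 < 8 ^ (1 + 2 * M))%N by rewrite expn_gt0.
  rewrite -(ltn_pmul2r P0) -e1; apply: leq_trans st.
  rewrite expnD; have s0 : (0 < 5 ^ s)%N by rewrite expn_gt0.
  rewrite (_ : 2 * (5 ^ M * 5 ^ s) * 8 ^ (1 + 2 * M) =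
     (2 * 5 ^ M * 8 ^ (1 + 2 * M)) * 5 ^ s)%N; last by ring.
  rewrite ltn_pmul2r //.
  apply: (@leq_trans (2 ^ (9 * M + 6))); last by rewrite leq_exp2l.
  rewrite (_ : 9 * M + 6 = 3 * (1 + M + (1 + 2 * M)))%N; last by lia.
  rewrite expnM -[(2 ^ 3)%N]/8%N [X in (_ < X)%N]expnD ltn_pmul2r // expnD expn1.
  have : (5 ^ M <= 8 ^ M)%N by case: (M) => // r; rewrite leq_exp2r.
  have : (0 < 8 ^ M)%N by rewrite expn_gt0.
  lia.
lia.
Qed.

(** By Bernoulli's inequality (1 + x)^k is at least 2, and (1 - x)(1 + x) is
at most 1. *)
Lemma one_minus_pow_le_half (R : realType) (x : R) (k : nat) :
  0 <= x <= 1 -> 1 <= k%:R * x -> (1 - x) ^+ k <= 2^-1.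
Proof.
move=> /andP[x0 x1] kx.
have y0 : 0 <= 1 - x by lra.
have B : 1 + k%:R * x <= (1 + x) ^+ k.
  elim: k {kx} => [|k IH]; first by rewrite expr0 mul0r addr0.
  rewrite exprS -natr1; have : 0 <= k%:R :> R by []; nra.
have P : (1 - x) ^+ k * (1 + x) ^+ k <= 1.
  by rewrite -exprMn exprn_ile1 ?mulr_ge0 //; nra.
rewrite -(@ler_pM2r _ 2) // mulVf ?pnatr_eq0 //.
apply: le_trans P; rewrite ler_wpM2l ?exprn_ge0 //; lra.
Qed.

(** Both 8^e p and (1 - q) 8^M are at least 1, hence so is 8^(M+e) q(1 - q),
and any 8^(M+e) factors 1 - q(1 - q) have product at most 1/2. This turns the
inequality into a comparison of exponents of 2. *)
Lemma union_bound_small (R : realType) (e M s : nat) (p q : R) :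
  (2 <= M)%N -> (e <= M)%N -> (3 * 8 ^ M <= s)%N ->
  0 < p -> 1 <= (8 ^ e)%:R * p -> p <= q <= 1 ->
  (1 - q) * 8 ^+ M >= 7 ^+ M ->
  (8 ^ M * 2 ^ (12 * (M + s + 9)) * (8 ^ s).+1 ^ (8 ^ M))%:R *
    (1 - q * (1 - q)) ^+ (8 ^ s.-1) < (2 ^+ (5 ^ (M + s)))^-1.
Proof.
move=> M2 eM Ms p0 ep /andP[pq q1] q7.
set x := q * (1 - q).
have q0 : 0 < q by lra.
have x01 : 0 <= x <= 1 by rewrite /x; apply/andP; split; nra.
have y0 : 0 <= 1 - x by move/andP: x01 => [x0 x1]; lra.
have half : (1 - x) ^+ (8 ^ (M + e)) <= 2^-1.
  apply: one_minus_pow_le_half => //.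
  rewrite expnD natrM /x !natrX.
  have -> : 8 ^+ M * 8 ^+ e * (q * (1 - q)) = (8 ^+ e * q) * ((1 - q) * 8 ^+ M) :> R by ring.
  have h1 : 1 <= 8 ^+ e * q.
    by apply: (le_trans ep); rewrite natrX ler_wpM2l ?exprn_ge0.
  have h2 : 1 <= (1 - q) * 8 ^+ M by apply: le_trans q7; rewrite exprn_ege1 // ler1n.
  by apply: (le_trans h1); rewrite ler_peMr // (le_trans ler01 h1).
have sE : (8 ^ s.-1 = 8 ^ (M + e) * 8 ^ (s.-1 - (M + e)))%N.
  rewrite -expnD; congr (8 ^ _)%N; have : (M < 8 ^ M)%N by rewrite ltn_expl.
  lia.
have small : (1 - x) ^+ (8 ^ s.-1) <= (2 ^+ (8 ^ (s - 1 - 2 * M)))^-1.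
  rewrite sE exprM -exprVn.
  apply: (@le_trans _ _ (2^-1 ^+ (8 ^ (s.-1 - (M + e))))).
    by apply: lerXn2r half; rewrite nnegrE ?exprn_ge0 ?invr_ge0.
  apply: ler_wiXn2l; rewrite ?invr_ge0 ?invf_le1 ?ler1n //.
  rewrite leq_exp2l //; lia.
have n8 (t : nat) : (8 ^ t = 2 ^ (3 * t))%N by rewrite (expnM 2 3).
have cnt : (8 ^ M * 2 ^ (12 * (M + s + 9)) * (8 ^ s).+1 ^ (8 ^ M) <=
    2 ^ (3 * M + 12 * (M + s + 9) + (3 * s + 1) * 8 ^ M))%N.
  rewrite n8 !expnD leq_mul // [X in (_ <= X)%N]expnM.
  have : ((8 ^ s).+1 <= 2 ^ (3 * s + 1))%N.
    have : (0 < 8 ^ s)%N by rewrite expn_gt0.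
    by rewrite expnD -n8 expn1; lia.
  by move=> s8; rewrite leq_exp2r // !muln_gt0 !expn_gt0.
have eb := exponent_bound M2 Ms.
have P2 (t : nat) : (0 : R) < 2 ^+ t by rewrite exprn_gt0.
apply: (@le_lt_trans _ _ ((2 ^ (3 * M + 12 * (M + s + 9) + (3 * s + 1) * 8 ^ M))%:R *
   (2 ^+ (8 ^ (s - 1 - 2 * M)))^-1)).
  by apply: ler_pM; rewrite ?ler0n ?exprn_ge0 ?ler_nat.
rewrite natrX ltr_pdivrMr // mulrC ltr_pdivlMr // -exprD ltr_eXn2l ?ltr1n //.
Qed.

(** * The random sets *)

Lemma total_probability (d : measure_display) (T : measurableType d) (R : realType)
    (P : probability T R) (Y : finType) (X : T -> Y) (D : set T) :
  measurable D -> (forall y, measurable [set w | X w = y]) ->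
  (P D = \sum_(y : Y) P (D `&` [set w | X w = y]))%E.
Proof.
move=> mD mX.
have {1}-> : D = \bigcup_(y in [set: Y]) (D `&` [set w | X w = y]).
  by apply/seteqP; split=> [w Dw|w [y _ []] //]; exists (X w).
rewrite measure_fin_bigcup //; last 3 first.
- exact: finite_finset.
- by move=> y y' _ _ [w [[_ <-] [_ <-]]].
- by move=> y _; apply: measurableI.
rewrite (fsbigE (index_enum Y)) ?index_enum_uniq //.
  by apply: eq_bigl => y; rewrite in_setT.
by move=> y _; rewrite mem_index_enum.
Qed.

Lemma union_bound (R : realType) (I T : finType) (w : T -> R) (B : pred T)
    (G : pred I) (D : I -> pred T) :
  (forall t, 0 <= w t) -> (forall t, B t -> exists i, G i && D i t) ->
  \sum_(t | B t) w t <= \sum_(i | G i) \sum_(t | D i t) w t.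
Proof.
move=> w0 cov; rewrite (exchange_big_dep xpredT) //= big_mkcond.
apply: ler_sum => t _; case: ifP => [/cov[i GD]|_]; last exact: sumr_ge0.
by rewrite (bigD1 i) //= lerDl sumr_ge0.
Qed.

Section Refinements.
Variables (R : realType) (p_ : nat -> rat) (s : nat -> nat) (i : nat).
Let M := psum s i.
Let N := psum s i.+1.
Let q : R := ratr (p_ i.+1).
Hypothesis p_nat : exists k : nat, p_ i.+1 * 8 ^+ s i.+1 = k%:R.
Hypothesis q01 : 0 <= q <= 1.
Variable A : {set dcube M}.

Lemma psumS : psum s i.+1 = (psum s i + s i.+1)%N.
Proof. by rewrite /psum big_ord_recr. Qed.

Lemma psum_leS : (M <= N)%N.
Proof. by rewrite /M /N psumS leq_addr. Qed.

Lemma card_stage_subcubes (Q : dcube M) : #|subcubes N Q| = (8 ^ s i.+1)%N.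
Proof. by rewrite card_subcubes ?psum_leS // /N /M psumS addKn. Qed.

(** The law of the comparison model: the cells below A are chosen
independently with probability q, and no other cell is ever chosen. *)
Definition cell_prob (B : dcube N) (chosen : bool) : R :=
  if parent M B \in A then (if chosen then q else 1 - q) else (~~ chosen)%:R.

Lemma cell_prob_ge0 B b : 0 <= cell_prob B b.
Proof.
move: q01 => /andP[q0 q1]; rewrite /cell_prob; case: ifP => _ //; case: b => //.
by rewrite subr_ge0.
Qed.

Lemma cell_prob_sum1 B : cell_prob B true + cell_prob B false = 1.
Proof. by rewrite /cell_prob; case: ifP => _; rewrite /= ?add0r // addrC subrK. Qed.

Definition refinement (V : {set dcube N}) : bool :=
  [forall Q, (Q \in A) ==> ((V :&: subcubes N Q)%SET \in choices p_ Q)] &&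
  (V == \bigcup_(Q in A) (V :&: subcubes N Q))%SET.

(** The conditional probability of each single refinement of A; it does not
depend on the refinement. *)
Definition refinement_prob : R :=
  \prod_(Q in A) (#|@choices p_ s i Q|%:R)^-1.

(** Both sides factor over the cubes Q of A, and for each Q the comparison is
uniform_le_bernoulli with k chosen cells among n; A has at most 8^M cubes. *)
Lemma refinement_prob_le_weight (V : {set dcube N}) : refinement V ->
  refinement_prob <= ((8 ^ s i.+1).+1 ^ (8 ^ M))%:R * weight cell_prob V.
Proof.
move=> /andP[/forallP ch /eqP VE].
have [k kE] := p_nat.
set n := (8 ^ s i.+1)%N.
have n0 : (0 < n)%N by rewrite expn_gt0.
have qn : q * n%:R = k%:R.
  by rewrite /q /n natrX -[8]ratr_nat -rmorphXn -rmorphM /= kE ratr_nat.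
have kn : (k <= n)%N.
  rewrite -(ler_nat R) -qn; move: q01 => /andP[q0 q1].
  by rewrite ler_piMl.
have chE Q : @choices p_ s i Q =
    [set C : {set dcube N} | (C \subset subcubes N Q) && (#|C| == k)]%SET.
  by apply/setP => C; rewrite !inE kE eqr_nat.
have cardch Q : #|@choices p_ s i Q| = 'C(n, k).
  by rewrite chE cards_draws card_stage_subcubes.
have cardV Q : Q \in A -> #|(V :&: subcubes N Q)%SET| = k.
  by move=> QA; have /implyP/(_ QA) := ch Q; rewrite chE inE => /andP[_ /eqP].
pose blk Q := \prod_(B | parent M B == Q) cell_prob B (B \in V).
have blkA Q : Q \in A -> blk Q = q ^+ k * (1 - q) ^+ (n - k).
  move=> QA; rewrite /blk (bigID (mem V)) /=; congr (_ * _).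
    rewrite (eq_bigr (fun=> q)); last first.
      by move=> B /andP[/eqP BQ BV]; rewrite /cell_prob BQ QA BV.
    rewrite big_const iter_mulr_1; congr (_ ^+ _); rewrite -(cardV Q QA).
    by apply: eq_card => B; rewrite [RHS]finset.in_setI mem_subcubes andbC.
  rewrite (eq_bigr (fun=> 1 - q)); last first.
    by move=> B /andP[/eqP BQ BV]; rewrite /cell_prob BQ QA (negbTE BV).
  rewrite big_const iter_mulr_1; congr (_ ^+ _).
  rewrite -(cardV Q QA) /n -(card_stage_subcubes Q) finset.setIC -cardsD.
  by apply: eq_card => B; rewrite [RHS]finset.in_setD mem_subcubes andbC.
have blkN Q : Q \notin A -> blk Q = 1.
  move=> QA; apply: big1 => B /eqP BQ; rewrite /cell_prob BQ (negbTE QA).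
  suff -> : B \notin V by [].
  rewrite VE; apply: contra QA => /bigcupP[Q' Q'A].
  by rewrite finset.in_setI mem_subcubes BQ => /andP[_ /eqP ->].
have wE : weight cell_prob V = \prod_(Q in A) (q ^+ k * (1 - q) ^+ (n - k)).
  rewrite /weight (partition_big (@parent M N) xpredT) //= (bigID (mem A)) /=.
  rewrite [X in _ * X]big1 ?mulr1; last by move=> Q; exact: blkN.
  by apply: eq_bigr => Q; exact: blkA.
rewrite wE /refinement_prob; apply: (@le_trans _ _
   (\prod_(Q in A) (n.+1%:R * (q ^+ k * (1 - q) ^+ (n - k))))).
  apply: ler_prod => Q QA; rewrite invr_ge0 ler0n /= cardch.
  exact: uniform_le_bernoulli.
rewrite big_split /= ler_wpM2r //.
  apply: prodr_ge0 => Q _; move: q01 => /andP[q0 q1].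
  by rewrite mulr_ge0 ?exprn_ge0 // subr_ge0.
rewrite prodr_const natrX; apply: ler_weXn2l; first by rewrite ler1n.
apply: (leq_trans (max_card _)).
by rewrite !card_prod !card_ord -!expnMn.
Qed.

(** After the passage to independent choices, which is made only once and for
all cubes of A together, this is a union bound over the pairs (Q, c); each
pair contributes the probability of one admissible system of implications. *)
Lemma sum_bad_refinements_le (Bad : pred {set dcube N}) :
  (0 < s i.+1)%N ->
  (forall V, Bad V -> refinement V -> exists Q (c : code N), [/\ Q \in A,
     admissible (cell_image R c) (even_subcubes N Q) &
     forall B, B \in even_subcubes N Q -> holds (cell_image R c) V B]) ->
  \sum_(V | refinement V && Bad V) refinement_prob <=
  (8 ^ M * 2 ^ (12 * (N + 9)) * (8 ^ s i.+1).+1 ^ (8 ^ M))%:R *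
    (1 - q * (1 - q)) ^+ (8 ^ (s i.+1).-1).
Proof.
move=> s0 cov; move: (q01) => /andP[q0 q1].
set K := ((8 ^ s i.+1).+1 ^ (8 ^ M))%N.
have x1 : 0 <= 1 - q * (1 - q) by nra.
have x2 : 1 - q * (1 - q) <= 1 by nra.
pose G (Qc : dcube M * code N) := (Qc.1 \in A) &&
   `[< admissible (cell_image R Qc.2) (even_subcubes N Qc.1) >].
pose D (Qc : dcube M * code N) (V : {set dcube N}) :=
  all (holds (cell_image R Qc.2) V) (enum (even_subcubes N Qc.1)).
apply: (@le_trans _ _ (K%:R * \sum_(V | refinement V && Bad V) weight cell_prob V)).
  rewrite mulr_sumr; apply: ler_sum => V /andP[vV _].
  exact: refinement_prob_le_weight.
rewrite natrM [X in _ <= X * _]mulrC -mulrA ler_wpM2l //.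
apply: (@le_trans _ _ (\sum_(Qc | G Qc) \sum_(V | D Qc V) weight cell_prob V)).
  apply: union_bound => [V|V /andP[vV bV]]; first exact/weight_ge0/cell_prob_ge0.
  have [Q [c [QA adm ok]]] := cov V bV vV.
  exists (Q, c); rewrite /G /D /= QA; apply/andP; split; first exact/asboolP.
  by apply/allP => B; rewrite mem_enum; apply: ok.
apply: (@le_trans _ _ (\sum_(Qc | G Qc) (1 - q * (1 - q)) ^+ (8 ^ (s i.+1).-1))).
  apply: ler_sum => -[Q c] /andP[/= QA /asboolP[a1 a2]].
  apply: le_trans (mean_implications (q := q) cell_prob_ge0 cell_prob_sum1 _ _ _ _ _) _.
  - exact: enum_uniq.
  - by move=> b b'; rewrite !mem_enum; apply: a1.
  - by move=> b1 b2 b'; rewrite !mem_enum; apply: a2.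
  - move=> b; rewrite mem_enum inE mem_subcubes => /andP[/eqP bQ _].
    by rewrite /cell_prob bQ QA.
  - move=> B; rewrite /cell_prob; case: ifP => // _ /=; lra.
  rewrite -cardE; apply: ler_wiXn2l => //.
  have MN : (M < N)%N by rewrite /M /N psumS -addn1 leq_add2l.
  have e : (N - M = s i.+1)%N by rewrite /N /M psumS addKn.
  by have := card_even_subcubes Q MN; rewrite e.
rewrite sumr_const -[X in X <= _]mulr_natl ler_wpM2r ?exprn_ge0 // ler_nat.
apply: (leq_trans (max_card _)); rewrite card_prod card_code leq_mul //.
by rewrite !card_prod !card_ord -!expnMn.
Qed.
End Refinements.

Section Process.
Variables (d : measure_display) (T : measurableType d) (R : realType).
Variables (P : probability T R) (p_ : nat -> rat) (s : nat -> nat).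
Variable F : forall i : nat, T -> {set dcube (psum s i)}.
Hypothesis F_random : random_cubes P p_ F.

Lemma random_refinement i w : refinement p_ (F i w) (F i.+1 w).
Proof.
apply/andP; split; last by rewrite -(rc_union F_random).
by apply/forallP => Q; apply/implyP; apply: (rc_chosen F_random).
Qed.

Definition same_history i w0 : set T :=
  [set w | forall j, (j <= i)%N -> F j w = F j w0].

(** On the given history the family V and its traces on the cubes of F i w0
determine each other, so the event is one of those whose probability the law
of the process prescribes. *)
Lemma next_stage_prob i w0 (V : {set dcube (psum s i.+1)}) :
  (P (same_history i w0 `&` [set w | F i.+1 w = V]) <=
   P (same_history i w0) *
     (if refinement p_ (F i w0) V then refinement_prob R p_ (F i w0) else 0)%:E)%E.
Proof.
case: ifPn => [/andP[/forallP ch /eqP VE]|inv]; last first.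
  rewrite mule0 (_ : _ `&` _ = set0) ?measure0 //.
  apply/seteqP; split=> // w [hw Vw]; move/negP: inv; apply.
  by rewrite -(hw i (leqnn i)) -Vw; apply: random_refinement.
pose C (Q : dcube (psum s i)) := (V :&: subcubes (psum s i.+1) Q)%SET.
have CP Q : Q \in F i w0 -> C Q \in choices p_ Q by move=> QA; apply: (implyP (ch Q)).
have := rc_law F_random (A := fun j => F j w0) CP.
rewrite /= -/(same_history i w0) /refinement_prob => <-.
rewrite le_eqVlt; apply/orP; left; apply/eqP; congr (P _).
apply/seteqP; split=> w [hw Vw]; split => //=; first by move=> Q _; rewrite Vw.
rewrite (rc_union F_random) (hw i (leqnn i)) VE.
by apply: eq_bigr => Q /Vw.
Qed.

Lemma measurable_event i (B : {set dcube (psum s i)} -> Prop) :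
  measurable [set w | B (F i w)].
Proof.
have -> : [set w | B (F i w)] =
    \bigcup_(V in [set V | B V]) [set w | F i w = V].
  by apply/seteqP; split=> w /= => [Bw|[V /= BV ->] //]; exists (F i w).
apply: fin_bigcup_measurable => [|V _]; first exact: finite_finset.
exact: (rc_measurable F_random).
Qed.

(** The law is prescribed conditionally on each history, so the event is
decomposed according to the finitely many values of the first i + 1 families.
A history that occurs is named by an outcome w0 in it, which avoids extending
finite sequences of families to infinite ones. *)
Lemma prob_le_of_histories i (B : {set dcube (psum s i.+1)} -> Prop) (b : R) :
  0 <= b ->
  (forall w0, \sum_(V | refinement p_ (F i w0) V && `[< B V >])
     refinement_prob R p_ (F i w0) <= b) ->
  (P [set w | B (F i.+1 w)] <= b%:E)%E.
Proof.
move=> b0 Hb; set E := [set w | _].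
have mE : measurable E by exact: measurable_event.
pose H w : {dffun forall j : 'I_i.+1, {set dcube (psum s j)}} := [ffun j : 'I_i.+1 => F j w].
have HE w0 : [set w | H w = H w0] = same_history i w0.
  apply/seteqP; split=> w /= Hw => [j ji|].
    by have /ffunP/(_ (Ordinal (ji : j < i.+1)%N)) := Hw; rewrite !ffunE.
  by apply/ffunP => j; rewrite !ffunE; apply: Hw; rewrite -ltnS.
have mH y : measurable [set w | H w = y].
  have -> : [set w | H w = y] = \bigcap_(j in [set: 'I_i.+1]) [set w | F j w = y j].
    apply/seteqP; split=> w /= => [<- j _ /=|Hw]; first by rewrite ffunE.
    by apply/ffunP => j; rewrite ffunE; apply: Hw.
  apply: fin_bigcap_measurable => [|j _]; first exact: finite_finset.
  exact: (rc_measurable F_random).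
rewrite (total_probability P mE mH).
apply: (@le_trans _ _ (\sum_y b%:E * P [set w | H w = y])%E); last first.
  rewrite -ge0_sume_distrr //.
  have := total_probability P measurableT mH; rewrite probability_setT.
  by under eq_bigr do rewrite setTI; move=> <-; rewrite mule1.
apply: lee_sum => y _.
have [[w0 Hw0]|no] := pselect (exists w0, H w0 = y); last first.
  have -> : [set w | H w = y] = set0.
    by apply/seteqP; split=> // w Hw; apply: no; exists w.
  by rewrite setI0 !measure0 mule0.
rewrite -Hw0 HE; set hist := same_history i w0.
have mhist : measurable hist by rewrite /hist -HE.
rewrite (total_probability P (measurableI _ _ mE mhist) (rc_measurable F_random (i := i.+1))).
have hfin : P hist \is a fin_num by apply: fin_num_measure.
apply: (@le_trans _ _ (\sum_(V | refinement p_ (F i w0) V && `[< B V >])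
   P hist * (refinement_prob R p_ (F i w0))%:E)%E); last first.
  rewrite -ge0_sume_distrr; last first.
    by move=> V _; rewrite lee_fin; apply: prodr_ge0 => Q _; rewrite invr_ge0.
  by rewrite muleC sumEFin lee_wpmul2r ?measure_ge0 // lee_fin.
rewrite [X in (_ <= X)%E]big_mkcond; apply: lee_sum => V _.
case: ifPn => [/andP[vV _]|].
  have := next_stage_prob w0 V; rewrite vV; apply: le_trans.
  apply: le_measure; rewrite ?inE.
  - by do ?[apply: measurableI] => //; apply: (rc_measurable F_random).
  - by apply: measurableI => //; apply: (rc_measurable F_random).
  - by move=> w [[_ hw] Vw]; split.
rewrite negb_and => /orP[nv|/asboolP nB].
  have := next_stage_prob w0 V; rewrite (negbTE nv) mule0; apply: le_trans.
  apply: le_measure; rewrite ?inE.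
  - by do ?[apply: measurableI] => //; apply: (rc_measurable F_random).
  - by apply: measurableI => //; apply: (rc_measurable F_random).
  - by move=> w [[_ hw] Vw]; split.
rewrite (_ : _ `&` _ = set0) ?measure0 //.
by apply/seteqP; split=> // w [[Ew _] Vw]; apply: nB; rewrite -Vw.
Qed.
End Process.

Lemma refinement_parent (p_ : nat -> rat) (s : nat -> nat) (i : nat)
    (A : {set dcube (psum s i)}) (V : {set dcube (psum s i.+1)}) B :
  refinement p_ A V -> B \in V -> parent (psum s i) B \in A.
Proof.
move=> /andP[_ /eqP VE]; rewrite VE => /bigcupP[Q QA].
by rewrite finset.in_setI mem_subcubes => /andP[_ /eqP ->].
Qed.

Lemma psum_gt (s : nat -> nat) (i : nat) :
  (forall j, (0 < s j)%N) -> (i < psum s i)%N.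
Proof.
move=> s_gt0; elim: i => [|i IH]; first by rewrite /psum big_ord1.
by rewrite psumS -addn1 leq_add.
Qed.

(** The partial products decrease to p, and each is at most its last factor
because all the factors are at most 1. *)
Lemma limit_le_factor (R : realType) (p : R) (p_ : nat -> rat) (i : nat) :
  (forall j, 0 < p_ j <= 1) ->
  (fun j : nat => ratr (pprod p_ j) : R) @ \oo --> p -> p <= ratr (p_ i.+1).
Proof.
move=> p01 cvp.
have P0 j : 0 <= pprod p_ j.
  by apply: prodr_ge0 => k _; have /andP[/ltW] := p01 k.
have PS j : pprod p_ j.+1 = pprod p_ j * p_ j.+1 by rewrite /pprod big_ord_recr.
have P1 j : pprod p_ j <= 1.
  by apply: prodr_ile1 => k _; have /andP[/ltW -> ->] := p01 k.
have dec : nonincreasing_seq (fun j : nat => ratr (pprod p_ j) : R).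
  apply/nonincreasing_seqP => j; rewrite ler_rat PS ler_piMr //.
  by have /andP[] := p01 j.+1.
have cv : cvgn (fun j : nat => ratr (pprod p_ j) : R) by apply/cvg_ex; exists p.
have := nonincreasing_cvgn_ge dec cv i.+1; rewrite (cvg_lim _ cvp) // => /le_trans.
apply; rewrite ler_rat PS ler_piMl //.
by have /andP[/ltW] := p01 i.+1.
Qed.

(** The cube Q is the ancestor of a cube of V that lies inside the
subcongruent cube. *)
Lemma subcongruent_covered (R : realType) (p_ : nat -> rat) (s : nat -> nat)
    (i S : nat) (A : {set dcube (psum s i)}) (V : {set dcube (psum s i.+1)}) :
  (S <= psum s i)%N -> refinement p_ A V ->
  contains_subcongruent S (dcomplex V : set (space3 R)) ->
  exists Q (c : code (psum s i.+1)), [/\ Q \in A,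
    admissible (cell_image R c) (even_subcubes (psum s i.+1) Q) &
    forall B, B \in even_subcubes (psum s i.+1) Q -> holds (cell_image R c) V B].
Proof.
move=> SM vV [A0 [pos [g [giso _ disj sub]]]].
have MN : (psum s i <= psum s i.+1)%N by rewrite psumS leq_addr.
have [B0 B0V B0A] := positive_measure_cell (leq_trans SM MN) pos.
have QA0 : parent S (parent (psum s i) B0) = A0 by rewrite parent_parent.
have [c adm ok] := subcongruence_code SM MN QA0 B0V B0A giso disj sub.
exists (parent (psum s i) B0), c; split => //; exact: (refinement_parent vV B0V).
Qed.

Theorem theorem3p1 (R : realType) (p : R) (p_ : nat -> rat) (s : nat -> nat)
    (p01 : 0 < p < 1)
    (p_0 : p_ 0%N = 1)
    (p_01 : forall i : nat, (1 <= i)%N -> 0 < p_ i < 1)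
    (s_gt0 : forall i : nat, (0 < s i)%N)
    (p_prod : (fun i : nat => ratr (pprod p_ i) : R) @ \oo --> p)
    (p_nat : forall i : nat, exists k : nat, p_ i * 8 ^+ s i = k%:R)
    (p_large : forall i : nat,
       (1 - p_ i.+1) * 8 ^+ psum s i >= 7 ^+ psum s i)
    (s_large : forall i : nat, (3 * 8 ^ psum s i <= s i.+1)%N)
    (d : measure_display) (T : measurableType d) (P : probability T R)
    (F : forall i : nat, T -> {set dcube (psum s i)})
    (F_random : random_cubes P p_ F) :
  forall S : nat, exists i0 : nat, forall i : nat, (i0 < i)%N ->
    (P [set w | contains_subcongruent S (dcomplex (F i w) : set (space3 R))]
       < (2 ^- (5 ^ psum s i))%:E)%E.
Proof.
move=> S.
have /andP[p0 _] := p01.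
have p_le1 j : 0 < p_ j <= 1.
  case: j => [|j]; first by rewrite p_0 ltr01 lexx.
  by have /andP[-> /ltW ->] := p_01 j.+1 isT.
have [e pe] : exists e : nat, 1 <= (8 ^ e)%:R * p.
  exists (Num.truncn p^-1).+1; rewrite -ler_pdivrMr // mul1r.
  apply: (@le_trans _ _ (Num.truncn p^-1).+1%:R).
    have pV0 : 0 <= p^-1 by rewrite invr_ge0 ltW.
    by have /andP[_ /ltW] := Num.Theory.truncn_itv pV0.
  by rewrite ler_nat ltnW // ltn_expl.
exists (maxn S (maxn e 2)) => -[|i] //; rewrite ltnS => i0i.
have Mi := psum_gt i s_gt0.
have SM : (S <= psum s i)%N by lia.
have eM : (e <= psum s i)%N by lia.
have M2 : (2 <= psum s i)%N by lia.
have pq := limit_le_factor i p_le1 p_prod.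
set q : R := ratr (p_ i.+1) in pq.
have q1 : q <= 1.
  by rewrite -(rmorph1 (ratr : rat -> R)) ler_rat; have /andP[] := p_le1 i.+1.
have q7 : (1 - q) * 8 ^+ psum s i >= 7 ^+ psum s i.
  have := p_large i; rewrite -(ler_rat R).
  by rewrite rmorphM rmorphB rmorph1 !rmorphXn /= !ratr_nat.
have q01 : 0 <= q <= 1 by rewrite q1 andbT (le_trans _ pq) // ltW.
have q01' : p <= q <= 1 by rewrite pq q1.
have := union_bound_small M2 eM (s_large i) p0 pe q01' q7.
rewrite -psumS -lte_fin; apply: le_lt_trans.
apply: (prob_le_of_histories F_random
  (B := fun V => contains_subcongruent S (dcomplex V : set (space3 R)))).
  by rewrite mulr_ge0 // exprn_ge0 //; move: q01 => /andP[]; nra.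
move=> w0; apply: sum_bad_refinements_le => // V /asboolP bad vV.
exact: (subcongruent_covered SM vV bad).
Qed.
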